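(* Let $\mathcal B$ be a (not necessarily strict) 2-category. After specifying a parenthesis scheme for the source and target 1-morphisms of a string diagram in $\mathcal B$, the resultant 2-morphism represented by the diagram is independent of the choice of parentheses, associators and unit 2-isomorphisms used to interpret the interior of the diagram.
   Context: A 2-category means a bicategory. A parenthesis scheme on a word of composable 1-morphisms is a choice of bracketing of the word, possibly with identity 1-morphisms inserted, so as to give an actual composite 1-morphism of $\mathcal B$. A string diagram, divided by a timeline so that each 2-morphism occurs in its own time segment, amounts to the following data: words $w_0,w_1,\dots,w_n$ of composable 1-morphisms (with fixed source and target objects), and for each $r=1,\dots,n$ a decomposition $w_{r-1}=x_ru_ry_r$, $w_r=x_rv_ry_r$ together with a 2-morphism $\phi_r$ of $\mathcal B$ whose source and target are given composites with specified parenthesis schemes having underlying words $u_r$ and $v_r$ respectively. The source and target 1-morphisms of the diagram are $w_0$ and $w_n$ with given parenthesis schemes. An interpretation of the diagram is a vertical composite from the given parenthesized $w_0$ to the given parenthesized $w_n$ which alternates between: composites of (whiskered) associators, unit isomorphisms and their inverses, which only change the parenthesis scheme; and, for each $r$ in turn, the 2-morphism obtained by horizontally composing $\phi_r$ with identity 2-morphisms on the remaining 1-morphisms $x_r,y_r$, in some parenthesis scheme of the whole word containing the source composite of $\phi_r$ as a bracketed sub-composite. The claim is that all interpretations give the same 2-morphism of $\mathcal B$. *)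

(* Defs.v *)
Set Implicit Arguments.
Unset Strict Implicit.
Unset Printing Implicit Defensive.

Declare Scope bicat_scope.
Delimit Scope bicat_scope with bicat.
Open Scope bicat_scope.

Reserved Notation "f ** g" (at level 40, left associativity).
Reserved Notation "f ==> g" (at level 70, no associativity).
Reserved Notation "al ;; be" (at level 50, left associativity).
Reserved Notation "al ## be" (at level 40, left associativity).

(* All compositions are written in diagrammatic order: [f ** g] is first [f],
   then [g], and [al ;; be] is first [al], then [be]. *)
Record bicategory := Bicategory {
  Ob : Type;
  Hom : Ob -> Ob -> Type;
  Hom2 : forall {a b : Ob}, Hom a b -> Hom a b -> Type
    where "f ==> g" := (Hom2 f g);

  id1 : forall a : Ob, Hom a a;
  comp1 : forall {a b c : Ob}, Hom a b -> Hom b c -> Hom a c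
    where "f ** g" := (comp1 f g);

  id2 : forall {a b : Ob} (f : Hom a b), f ==> f;
  vcomp : forall {a b : Ob} {f g h : Hom a b}, f ==> g -> g ==> h -> f ==> h
    where "al ;; be" := (vcomp al be);
  hcomp : forall {a b c : Ob} {f f' : Hom a b} {g g' : Hom b c},
    f ==> f' -> g ==> g' -> f ** g ==> f' ** g'
    where "al ## be" := (hcomp al be);

  assoc : forall {a b c d : Ob} (f : Hom a b) (g : Hom b c) (h : Hom c d),
    (f ** g) ** h ==> f ** (g ** h);
  assoc_inv : forall {a b c d : Ob} (f : Hom a b) (g : Hom b c) (h : Hom c d),
    f ** (g ** h) ==> (f ** g) ** h;
  lunit : forall {a b : Ob} (f : Hom a b), id1 a ** f ==> f;
  lunit_inv : forall {a b : Ob} (f : Hom a b), f ==> id1 a ** f;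
  runit : forall {a b : Ob} (f : Hom a b), f ** id1 b ==> f;
  runit_inv : forall {a b : Ob} (f : Hom a b), f ==> f ** id1 b;

  vcomp_id_l : forall (a b : Ob) (f g : Hom a b) (al : f ==> g),
    id2 f ;; al = al;
  vcomp_id_r : forall (a b : Ob) (f g : Hom a b) (al : f ==> g),
    al ;; id2 g = al;
  vcomp_assoc : forall (a b : Ob) (f g h k : Hom a b)
      (al : f ==> g) (be : g ==> h) (ga : h ==> k),
    (al ;; be) ;; ga = al ;; (be ;; ga);

  hcomp_id : forall (a b c : Ob) (f : Hom a b) (g : Hom b c),
    id2 f ## id2 g = id2 (f ** g);
  interchange : forall (a b c : Ob) (f f' f'' : Hom a b) (g g' g'' : Hom b c)
      (al : f ==> f') (al' : f' ==> f'') (be : g ==> g') (be' : g' ==> g''),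
    (al ;; al') ## (be ;; be') = (al ## be) ;; (al' ## be');

  assoc_natural : forall (a b c d : Ob)
      (f f' : Hom a b) (g g' : Hom b c) (h h' : Hom c d)
      (al : f ==> f') (be : g ==> g') (ga : h ==> h'),
    ((al ## be) ## ga) ;; assoc f' g' h' = assoc f g h ;; (al ## (be ## ga));
  lunit_natural : forall (a b : Ob) (f f' : Hom a b) (al : f ==> f'),
    (id2 (id1 a) ## al) ;; lunit f' = lunit f ;; al;
  runit_natural : forall (a b : Ob) (f f' : Hom a b) (al : f ==> f'),
    (al ## id2 (id1 b)) ;; runit f' = runit f ;; al;

  assocK : forall (a b c d : Ob) (f : Hom a b) (g : Hom b c) (h : Hom c d),
    assoc f g h ;; assoc_inv f g h = id2 ((f ** g) ** h);
  assoc_invK : forall (a b c d : Ob) (f : Hom a b) (g : Hom b c) (h : Hom c d),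
    assoc_inv f g h ;; assoc f g h = id2 (f ** (g ** h));
  lunitK : forall (a b : Ob) (f : Hom a b),
    lunit f ;; lunit_inv f = id2 (id1 a ** f);
  lunit_invK : forall (a b : Ob) (f : Hom a b),
    lunit_inv f ;; lunit f = id2 f;
  runitK : forall (a b : Ob) (f : Hom a b),
    runit f ;; runit_inv f = id2 (f ** id1 b);
  runit_invK : forall (a b : Ob) (f : Hom a b),
    runit_inv f ;; runit f = id2 f;

  pentagon : forall (a b c d e : Ob)
      (f : Hom a b) (g : Hom b c) (h : Hom c d) (k : Hom d e),
    (assoc f g h ## id2 k) ;; assoc f (g ** h) k ;; (id2 f ## assoc g h k)
    = assoc (f ** g) h k ;; assoc f g (h ** k);
  triangle : forall (a b c : Ob) (f : Hom a b) (g : Hom b c),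
    assoc f (id1 b) g ;; (id2 f ## lunit g) = runit f ## id2 g
}.

Arguments Hom2 {_ _ _} _ _.
Arguments id1 {_} _.
Arguments comp1 {_ _ _ _} _ _.
Arguments id2 {_ _ _} _.
Arguments vcomp {_ _ _ _ _ _} _ _.
Arguments hcomp {_ _ _ _ _ _ _ _} _ _.
Arguments assoc {_ _ _ _ _} _ _ _.
Arguments assoc_inv {_ _ _ _ _} _ _ _.
Arguments lunit {_ _ _} _.
Arguments lunit_inv {_ _ _} _.
Arguments runit {_ _ _} _.
Arguments runit_inv {_ _ _} _.

Notation "f ==> g" := (Hom2 f g) : bicat_scope.
Notation "f ** g" := (comp1 f g) : bicat_scope.
Notation "al ;; be" := (vcomp al be) : bicat_scope.
Notation "al ## be" := (hcomp al be) : bicat_scope.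

Inductive word (B : bicategory) : Ob B -> Ob B -> Type :=
| wnil (a : Ob B) : word a a
| wcons (a b c : Ob B) (f : Hom a b) (w : word b c) : word a c.

Arguments wnil {B} a.

Fixpoint wcat (B : bicategory) (a b c : Ob B) (w : word a b) :
    word b c -> word a c :=
  match w in word a b return word b c -> word a c with
  | wnil _ => fun w' => w'
  | wcons f v => fun w' => wcons f (wcat v w')
  end.

(* An identity inserted by the scheme, [s_unit], is not a letter of the
   underlying word; it is distinct from the letter [s_gen (id1 a)]. *)
Inductive scheme (B : bicategory) : Ob B -> Ob B -> Type :=
| s_unit (a : Ob B) : scheme a a
| s_gen (a b : Ob B) (f : Hom a b) : scheme a b
| s_comp (a b c : Ob B) (s : scheme a b) (t : scheme b c) : scheme a c.

Arguments s_unit {B} a.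

Fixpoint composite (B : bicategory) (a b : Ob B) (s : scheme a b) : Hom a b :=
  match s with
  | s_unit a => id1 a
  | s_gen f => f
  | s_comp s t => composite s ** composite t
  end.

(* [s] is a parenthesis scheme on the word [w] when [underlying s = w]. *)
Fixpoint underlying (B : bicategory) (a b : Ob B) (s : scheme a b) : word a b :=
  match s with
  | s_unit a => wnil a
  | s_gen f => wcons f (wnil _)
  | s_comp s t => wcat (underlying s) (underlying t)
  end.

Inductive rebracketing (B : bicategory) :
    forall a b : Ob B, scheme a b -> scheme a b -> Type :=
| rb_refl (a b : Ob B) (s : scheme a b) : rebracketing s s
| rb_trans (a b : Ob B) (s t u : scheme a b) :
    rebracketing s t -> rebracketing t u -> rebracketing s u
| rb_whisker_l (a b c : Ob B) (s : scheme a b) (t t' : scheme b c) :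
    rebracketing t t' -> rebracketing (s_comp s t) (s_comp s t')
| rb_whisker_r (a b c : Ob B) (s s' : scheme a b) (t : scheme b c) :
    rebracketing s s' -> rebracketing (s_comp s t) (s_comp s' t)
| rb_assoc (a b c d : Ob B)
    (s : scheme a b) (t : scheme b c) (u : scheme c d) :
    rebracketing (s_comp (s_comp s t) u) (s_comp s (s_comp t u))
| rb_assoc_inv (a b c d : Ob B)
    (s : scheme a b) (t : scheme b c) (u : scheme c d) :
    rebracketing (s_comp s (s_comp t u)) (s_comp (s_comp s t) u)
| rb_lunit (a b : Ob B) (s : scheme a b) :
    rebracketing (s_comp (s_unit a) s) s
| rb_lunit_inv (a b : Ob B) (s : scheme a b) :
    rebracketing s (s_comp (s_unit a) s)
| rb_runit (a b : Ob B) (s : scheme a b) :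
    rebracketing (s_comp s (s_unit b)) s
| rb_runit_inv (a b : Ob B) (s : scheme a b) :
    rebracketing s (s_comp s (s_unit b)).

Fixpoint rebracketing_cell (B : bicategory) (a b : Ob B) (s t : scheme a b)
    (r : rebracketing s t) : composite s ==> composite t :=
  match r in rebracketing s t return composite s ==> composite t with
  | rb_refl s => id2 (composite s)
  | rb_trans r1 r2 => rebracketing_cell r1 ;; rebracketing_cell r2
  | rb_whisker_l s r => id2 (composite s) ## rebracketing_cell r
  | rb_whisker_r t r => rebracketing_cell r ## id2 (composite t)
  | rb_assoc s t u => assoc (composite s) (composite t) (composite u)
  | rb_assoc_inv s t u => assoc_inv (composite s) (composite t) (composite u)
  | rb_lunit s => lunit (composite s)
  | rb_lunit_inv s => lunit_inv (composite s)
  | rb_runit s => runit (composite s)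
  | rb_runit_inv s => runit_inv (composite s)
  end.

(* Parenthesis schemes from [a] to [b] with one hole, to be filled by a scheme
   from [c] to [d], which then occurs as a bracketed sub-composite. *)
Inductive context (B : bicategory) (c d : Ob B) : Ob B -> Ob B -> Type :=
| c_hole : context c d c d
| c_left (a a' b : Ob B) (s : scheme a a') (K : context c d a' b) :
    context c d a b
| c_right (a b b' : Ob B) (K : context c d a b) (s : scheme b b') :
    context c d a b'.

Fixpoint plug (B : bicategory) (c d a b : Ob B) (K : context c d a b)
    (p : scheme c d) : scheme a b :=
  match K with
  | c_hole _ _ => p
  | c_left s K => s_comp s (plug K p)
  | c_right K s => s_comp (plug K p) s
  end.

Fixpoint word_before (B : bicategory) (c d a b : Ob B) (K : context c d a b) :
    word a c :=
  match K with
  | c_hole _ _ => wnil c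
  | c_left s K => wcat (underlying s) (word_before K)
  | c_right K _ => word_before K
  end.

Fixpoint word_after (B : bicategory) (c d a b : Ob B) (K : context c d a b) :
    word d b :=
  match K with
  | c_hole _ _ => wnil d
  | c_left _ K => word_after K
  | c_right K s => wcat (word_after K) (underlying s)
  end.

Fixpoint whisker (B : bicategory) (c d a b : Ob B) (K : context c d a b)
    (p q : scheme c d) (phi : composite p ==> composite q) :
    composite (plug K p) ==> composite (plug K q) :=
  match K in context _ _ a b
    return composite (plug K p) ==> composite (plug K q) with
  | c_hole _ _ => phi
  | c_left s K => id2 (composite s) ## whisker K phi
  | c_right K s => whisker K phi ## id2 (composite s)
  end.

(* One time segment [w = x u y], [w' = x v y], where [u] and [v] are the
   underlying words of the parenthesized source and target of [l_cell]. *)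
Record layer (B : bicategory) (a b : Ob B) (w w' : word a b) := Layer {
  l_src : Ob B;
  l_tgt : Ob B;
  l_before : word a l_src;
  l_after : word l_tgt b;
  l_dom : scheme l_src l_tgt;
  l_cod : scheme l_src l_tgt;
  l_cell : composite l_dom ==> composite l_cod;
  l_domE : w = wcat l_before (wcat (underlying l_dom) l_after);
  l_codE : w' = wcat l_before (wcat (underlying l_cod) l_after)
}.

Inductive diagram (B : bicategory) (a b : Ob B) : word a b -> word a b -> Type :=
| d_nil (w : word a b) : diagram w w
| d_cons (w0 w1 wn : word a b) (L : layer w0 w1) (D : diagram w1 wn) :
    diagram w0 wn.

Inductive interpretation (B : bicategory) (a b : Ob B) :
    forall w w' : word a b, diagram w w' -> scheme a b -> scheme a b -> Type :=
| i_nil (w : word a b) (s t : scheme a b) (r : rebracketing s t) :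
    interpretation (d_nil w) s t
| i_cons (w0 w1 wn : word a b) (L : layer w0 w1) (D : diagram w1 wn)
    (s t : scheme a b) (K : context (l_src L) (l_tgt L) a b)
    (beforeE : word_before K = l_before L)
    (afterE : word_after K = l_after L)
    (r : rebracketing s (plug K (l_dom L)))
    (J : interpretation D (plug K (l_cod L)) t) :
    interpretation (d_cons L D) s t.

Fixpoint interpretation_cell (B : bicategory) (a b : Ob B) (w w' : word a b)
    (D : diagram w w') (s t : scheme a b) (J : interpretation D s t) :
    composite s ==> composite t :=
  match J in interpretation _ s t return composite s ==> composite t with
  | i_nil _ r => rebracketing_cell r
  | @i_cons _ _ _ _ _ _ L _ _ _ K _ _ r J =>
      rebracketing_cell r ;; whisker K (l_cell L) ;; interpretation_cell J
  end.

(* Main.v *)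
From Stdlib Require Import ssreflect Eqdep.
Require Import Defs.

Set Implicit Arguments.
Unset Strict Implicit.
Unset Printing Implicit Defensive.

(** The theorem has two ingredients.

    Coherence ([rebracketing_coherence]): any two rebracketings between the
    same schemes have the same 2-cell.  A scheme [s] from [a] to [b] acts on the
    1-morphisms [x] out of [b] by composing its letters onto [x] one at a time,
    from the right, and there is a canonical invertible 2-cell
    [act_cell s x : composite s ** x ==> act s x].  The action forgets the
    bracketing: associators and unit isomorphisms relate schemes whose actions
    are the same function, up to computation.  Hence [act_cell] is compatible
    with every rebracketing cell ([rebracketing_act_cell]), which reduces to
    the pentagon, the triangle and Kelly's identity
    [assoc 1 f g ;; lunit (f ** g) = lunit f ## id2 g].  As [act_cell] is
    invertible, it determines the 2-cell of a rebracketing, whiskered by [x];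
    for [x] an identity, the whiskering is faithful.

    Naturality in the hole ([ctx_equiv_words]): if two contexts have the same
    words to the left and to the right of their holes, then they are related by
    rebracketings that never look inside the hole, and which therefore commute
    with any 2-cell placed there.

    Two interpretations of a diagram are then compared layer by layer.  Suppose
    they start at schemes related by a rebracketing.  In the first layer they
    whisker the same 2-cell by two contexts with the same words; the
    rebracketing between these contexts slides past the 2-cell, and coherence
    makes the resulting square of rebracketings before it commute.  What
    remains is the same problem for the rest of the diagram. *)

(** * Cancellation and Kelly's unit identity *)

Section Bicategory.
Variable B : bicategory.
Implicit Types a b c d : Ob B.

Lemma vcomp_cancel_l a b (f g h : Hom a b) (al : f ==> g) (al' : g ==> f)
    (be ga : g ==> h) :
  al' ;; al = id2 g -> al ;; be = al ;; ga -> be = ga.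
Proof.
move=> alK E.
by rewrite -(vcomp_id_l be) -(vcomp_id_l ga) -alK !vcomp_assoc E.
Qed.

Lemma vcomp_cancel_r a b (f g h : Hom a b) (al : g ==> h) (al' : h ==> g)
    (be ga : f ==> g) :
  al ;; al' = id2 g -> be ;; al = ga ;; al -> be = ga.
Proof.
move=> alK E.
by rewrite -(vcomp_id_r be) -(vcomp_id_r ga) -alK -!vcomp_assoc E.
Qed.

Lemma whisker_l_vcomp a b c (f : Hom a b) (g h k : Hom b c)
    (al : g ==> h) (be : h ==> k) :
  id2 f ## (al ;; be) = (id2 f ## al) ;; (id2 f ## be).
Proof. by rewrite -interchange vcomp_id_l. Qed.

Lemma whisker_r_vcomp a b c (f g h : Hom a b) (k : Hom b c)
    (al : f ==> g) (be : g ==> h) :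
  (al ;; be) ## id2 k = (al ## id2 k) ;; (be ## id2 k).
Proof. by rewrite -interchange vcomp_id_l. Qed.

Lemma whisker_exchange a b c (f f' : Hom a b) (g g' : Hom b c)
    (al : f ==> f') (be : g ==> g') :
  (al ## id2 g) ;; (id2 f' ## be) = (id2 f ## be) ;; (al ## id2 g').
Proof. by rewrite -!interchange !vcomp_id_l !vcomp_id_r. Qed.

Lemma whisker_id1_l_inj a b (f g : Hom a b) (al be : f ==> g) :
  id2 (id1 a) ## al = id2 (id1 a) ## be -> al = be.
Proof.
move=> E; apply: (vcomp_cancel_l (lunit_invK f)).
by rewrite -!lunit_natural E.
Qed.

Lemma whisker_id1_r_inj a b (f g : Hom a b) (al be : f ==> g) :
  al ## id2 (id1 b) = be ## id2 (id1 b) -> al = be.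
Proof.
move=> E; apply: (vcomp_cancel_l (runit_invK f)).
by rewrite -!runit_natural E.
Qed.

(** Kelly's argument: whiskering by an identity on the left is faithful, and
    after that whiskering both sides can be compared along the pentagon for
    [1, 1, f, g], where the triangle turns each of them into
    [runit 1 ## id2 (f ** g)]. *)
Lemma lunit_comp1 a b c (f : Hom a b) (g : Hom b c) :
  assoc (id1 a) f g ;; lunit (f ** g) = lunit f ## id2 g.
Proof.
apply: whisker_id1_l_inj.
apply: (@vcomp_cancel_l _ _ _ _ _ (assoc (id1 a) (id1 a ** f) g)
          (assoc_inv _ _ _)); first exact: assoc_invK.
apply: (@vcomp_cancel_l _ _ _ _ _ (assoc (id1 a) (id1 a) f ## id2 g)
          (assoc_inv _ _ _ ## id2 g)).
  by rewrite -whisker_r_vcomp assoc_invK hcomp_id.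
rewrite whisker_l_vcomp -!vcomp_assoc pentagon vcomp_assoc triangle.
rewrite [in RHS]vcomp_assoc -assoc_natural -vcomp_assoc -whisker_r_vcomp.
by rewrite triangle assoc_natural hcomp_id.
Qed.

(** * Coherence *)

Fixpoint act a b (s : scheme a b) : forall c, Hom b c -> Hom a c :=
  match s in scheme a b return forall c, Hom b c -> Hom a c with
  | s_unit _ => fun c x => x
  | s_gen f => fun c x => f ** x
  | s_comp s t => fun c x => act s (act t x)
  end.

Fixpoint act_cell a b (s : scheme a b) :
    forall c (x : Hom b c), composite s ** x ==> act s x :=
  match s in scheme a b
    return forall c (x : Hom b c), composite s ** x ==> act s x with
  | s_unit _ => fun c x => lunit x
  | s_gen f => fun c x => id2 (f ** x)
  | s_comp s t => fun c x =>
      assoc (composite s) (composite t) x ;;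
      (id2 (composite s) ## act_cell t x) ;; act_cell s (act t x)
  end.

Lemma act_cell_invertible a b (s : scheme a b) c (x : Hom b c) :
  exists be, act_cell s x ;; be = id2 (composite s ** x).
Proof.
elim: s c x => {a b} [a | a b f | a b e s IHs t IHt] c x /=.
- by exists (lunit_inv x); exact: lunitK.
- by exists (id2 (f ** x)); exact: vcomp_id_l.
- have [be beK] := IHt c x; have [ga gaK] := IHs c (act t x).
  exists (ga ;; (id2 (composite s) ## be) ;; assoc_inv _ _ _).
  rewrite !vcomp_assoc -(vcomp_assoc (act_cell s _)) gaK vcomp_id_l.
  rewrite -(vcomp_assoc (_ ## _)) -whisker_l_vcomp beK hcomp_id vcomp_id_l.
  exact: assocK.
Qed.

(** The target varies because [act s x] and [act t x] are equal but not
    convertible when [s] and [t] are arbitrary schemes related by a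
    rebracketing.  Equations in this type avoid transport along such equalities,
    and for 2-cells with the same target they are equations of 2-cells
    ([out_inj]). *)
Definition out_cell a b (f : Hom a b) := {h : Hom a b & f ==> h}.

Definition out a b (f h : Hom a b) (al : f ==> h) : out_cell f :=
  existT (fun h => f ==> h) h al.

Lemma out_inj a b (f h : Hom a b) (al be : f ==> h) : out al = out be -> al = be.
Proof. exact: inj_pair2. Qed.

Lemma out_precomp a b (f g h h' : Hom a b) (al : f ==> g)
    (be : g ==> h) (be' : g ==> h') :
  out be = out be' -> out (al ;; be) = out (al ;; be').
Proof.
exact: (f_equal (fun u : out_cell g => out (al ;; projT2 u))).
Qed.

Lemma out_act a b c (s : scheme a b) (f h h' : Hom b c)
    (be : f ==> h) (be' : f ==> h') :
  out be = out be' ->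
  out ((id2 (composite s) ## be) ;; act_cell s h)
  = out ((id2 (composite s) ## be') ;; act_cell s h').
Proof.
exact: (f_equal (fun u : out_cell f =>
  out ((id2 (composite s) ## projT2 u) ;; act_cell s (projT1 u)))).
Qed.

Lemma act_cell_assoc a b c d e (s : scheme a b) (t : scheme b c)
    (u : scheme c d) (x : Hom d e) :
  (assoc (composite s) (composite t) (composite u) ## id2 x) ;;
  act_cell (s_comp s (s_comp t u)) x
  = act_cell (s_comp (s_comp s t) u) x.
Proof.
rewrite /= !whisker_l_vcomp -!vcomp_assoc pentagon.
congr (_ ;; _ ;; _).
by rewrite !vcomp_assoc -assoc_natural hcomp_id.
Qed.

Lemma act_cell_lunit a b c (s : scheme a b) (x : Hom b c) :
  (lunit (composite s) ## id2 x) ;; act_cell s x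
  = act_cell (s_comp (s_unit a) s) x.
Proof. by rewrite /= vcomp_assoc lunit_natural -vcomp_assoc lunit_comp1. Qed.

Lemma act_cell_runit a b c (s : scheme a b) (x : Hom b c) :
  (runit (composite s) ## id2 x) ;; act_cell s x
  = act_cell (s_comp s (s_unit b)) x.
Proof. by rewrite /= triangle. Qed.

Lemma whisker_r_flip a b c (f g : Hom a b) (x : Hom b c) (h : Hom a c)
    (al : f ==> g) (al' : g ==> f) (be : g ** x ==> h) (ga : f ** x ==> h) :
  al' ;; al = id2 g -> (al ## id2 x) ;; be = ga -> (al' ## id2 x) ;; ga = be.
Proof.
by move=> alK <-; rewrite -vcomp_assoc -whisker_r_vcomp alK hcomp_id vcomp_id_l.
Qed.

Lemma rebracketing_act_cell a b (s t : scheme a b) (r : rebracketing s t)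
    c (x : Hom b c) :
  out ((rebracketing_cell r ## id2 x) ;; act_cell t x) = out (act_cell s x).
Proof.
elim: r c x => {a b s t}
  [a b s | a b s t u r1 IH1 r2 IH2 | a b e s t t' r IH | a b e s s' t r IH
  | a b e d s t u | a b e d s t u | a b s | a b s | a b s | a b s] c x.
- by rewrite /= hcomp_id vcomp_id_l.
- rewrite /= whisker_r_vcomp vcomp_assoc -IH1.
  exact/out_precomp/IH2.
- rewrite /= -!vcomp_assoc assoc_natural.
  rewrite (vcomp_assoc (assoc _ _ _)) -whisker_l_vcomp !vcomp_assoc.
  exact/out_precomp/out_act/IH.
- rewrite /= -!vcomp_assoc assoc_natural hcomp_id.
  rewrite (vcomp_assoc (assoc _ _ _)) whisker_exchange -vcomp_assoc.
  rewrite (vcomp_assoc (_ ;; _)).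
  exact/out_precomp/IH.
- congr out; exact: act_cell_assoc.
- congr out; exact: whisker_r_flip (assoc_invK _ _ _) (act_cell_assoc _ _ _ _).
- congr out; exact: act_cell_lunit.
- congr out; exact: whisker_r_flip (lunit_invK _) (act_cell_lunit _ _).
- congr out; exact: act_cell_runit.
- congr out; exact: whisker_r_flip (runit_invK _) (act_cell_runit _ _).
Qed.

Theorem rebracketing_coherence a b (s t : scheme a b) (r r' : rebracketing s t) :
  rebracketing_cell r = rebracketing_cell r'.
Proof.
apply: whisker_id1_r_inj.
have [be beK] := act_cell_invertible t (id1 b).
apply: (vcomp_cancel_r beK); apply: out_inj.
by rewrite !rebracketing_act_cell.
Qed.

Fixpoint rb_inv a b (s t : scheme a b) (r : rebracketing s t) :
    rebracketing t s :=
  match r in rebracketing s t return rebracketing t s with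
  | rb_refl s => rb_refl s
  | rb_trans r1 r2 => rb_trans (rb_inv r2) (rb_inv r1)
  | rb_whisker_l s r => rb_whisker_l s (rb_inv r)
  | rb_whisker_r t r => rb_whisker_r t (rb_inv r)
  | rb_assoc s t u => rb_assoc_inv s t u
  | rb_assoc_inv s t u => rb_assoc s t u
  | rb_lunit s => rb_lunit_inv s
  | rb_lunit_inv s => rb_lunit s
  | rb_runit s => rb_runit_inv s
  | rb_runit_inv s => rb_runit s
  end.

(** [rb_trans r (rb_inv r)] and [rb_refl s] are parallel, so this is an instance
    of coherence. *)
Lemma rb_invK a b (s t : scheme a b) (r : rebracketing s t) :
  rebracketing_cell r ;; rebracketing_cell (rb_inv r) = id2 (composite s).
Proof. exact: (rebracketing_coherence (rb_trans r (rb_inv r)) (rb_refl s)). Qed.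

Lemma rb_inv_cellK a b (s t : scheme a b) (r : rebracketing s t) :
  rebracketing_cell (rb_inv r) ;; rebracketing_cell r = id2 (composite t).
Proof. exact: (rebracketing_coherence (rb_trans (rb_inv r) r) (rb_refl t)). Qed.

(** * Contexts up to rebracketings natural in the hole *)

Definition ctx_equiv c d a b (K K' : context c d a b) : Prop :=
  exists rho : forall p, rebracketing (plug K p) (plug K' p),
    forall p q (phi : composite p ==> composite q),
      whisker K phi ;; rebracketing_cell (rho q)
      = rebracketing_cell (rho p) ;; whisker K' phi.

Lemma ctx_equiv_trans c d a b (K L M : context c d a b) :
  ctx_equiv K L -> ctx_equiv L M -> ctx_equiv K M.
Proof.
move=> [rho rhoN] [sig sigN]; exists (fun p => rb_trans (rho p) (sig p)).
by move=> p q phi /=; rewrite -vcomp_assoc rhoN !vcomp_assoc sigN.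
Qed.

Lemma ctx_equiv_sym c d a b (K L : context c d a b) :
  ctx_equiv K L -> ctx_equiv L K.
Proof.
move=> [rho rhoN]; exists (fun p => rb_inv (rho p)) => p q phi.
apply: (vcomp_cancel_l (rb_inv_cellK (rho p))).
by rewrite -!vcomp_assoc -rhoN rb_invK vcomp_id_l vcomp_assoc rb_invK vcomp_id_r.
Qed.

Lemma ctx_equiv_left c d a b e (s : scheme e a) (K L : context c d a b) :
  ctx_equiv K L -> ctx_equiv (c_left s K) (c_left s L).
Proof.
move=> [rho rhoN]; exists (fun p => rb_whisker_l s (rho p)) => p q phi /=.
by rewrite -!whisker_l_vcomp rhoN.
Qed.

Lemma ctx_equiv_right c d a b e (K L : context c d a b) (s : scheme b e) :
  ctx_equiv K L -> ctx_equiv (c_right K s) (c_right L s).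
Proof.
move=> [rho rhoN]; exists (fun p => rb_whisker_r s (rho p)) => p q phi /=.
by rewrite -!whisker_r_vcomp rhoN.
Qed.

Lemma ctx_equiv_left_scheme c d a b e (s t : scheme e a) (K : context c d a b) :
  rebracketing s t -> ctx_equiv (c_left s K) (c_left t K).
Proof.
move=> r; exists (fun p => rb_whisker_r (plug K p) r) => p q phi /=.
by rewrite whisker_exchange.
Qed.

Lemma ctx_equiv_right_scheme c d a b e (K : context c d a b) (s t : scheme b e) :
  rebracketing s t -> ctx_equiv (c_right K s) (c_right K t).
Proof.
move=> r; exists (fun p => rb_whisker_l (plug K p) r) => p q phi /=.
by rewrite whisker_exchange.
Qed.

Lemma ctx_equiv_left_comp c d a b e f (s : scheme f e) (t : scheme e a)
    (K : context c d a b) :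
  ctx_equiv (c_left (s_comp s t) K) (c_left s (c_left t K)).
Proof.
exists (fun p => rb_assoc s t (plug K p)) => p q phi /=.
by rewrite -hcomp_id assoc_natural.
Qed.

Lemma ctx_equiv_right_comp c d a b e f (K : context c d a b) (s : scheme b e)
    (t : scheme e f) :
  ctx_equiv (c_right (c_right K s) t) (c_right K (s_comp s t)).
Proof.
exists (fun p => rb_assoc (plug K p) s t) => p q phi /=.
by rewrite -hcomp_id assoc_natural.
Qed.

Lemma ctx_equiv_left_right c d a b e f (s : scheme e a) (K : context c d a b)
    (t : scheme b f) :
  ctx_equiv (c_right (c_left s K) t) (c_left s (c_right K t)).
Proof.
exists (fun p => rb_assoc s (plug K p) t) => p q phi /=.
by rewrite assoc_natural.
Qed.

Lemma ctx_equiv_left_unit c d a b (K : context c d a b) :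
  ctx_equiv (c_left (s_unit a) K) K.
Proof.
by exists (fun p => rb_lunit (plug K p)) => p q phi /=; rewrite lunit_natural.
Qed.

Lemma ctx_equiv_right_unit c d a b (K : context c d a b) :
  ctx_equiv (c_right K (s_unit b)) K.
Proof.
by exists (fun p => rb_runit (plug K p)) => p q phi /=; rewrite runit_natural.
Qed.

Fixpoint word_scheme a b (w : word a b) : scheme a b :=
  match w in word a b return scheme a b with
  | wnil a => s_unit a
  | wcons f w => s_comp (s_gen f) (word_scheme w)
  end.

Lemma rb_wcat a b c (v : word a b) (w : word b c) :
  rebracketing (s_comp (word_scheme v) (word_scheme w)) (word_scheme (wcat v w)).
Proof.
elim: v c w => {a b} [a | a b e f v IH] c w /=; first exact: rb_lunit.
exact: rb_trans (rb_assoc _ _ _) (rb_whisker_l _ (IH c w)).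
Qed.

Lemma rb_underlying a b (s : scheme a b) :
  rebracketing s (word_scheme (underlying s)).
Proof.
elim: s => {a b} [a | a b f | a b c s IHs t IHt] /=.
- exact: rb_refl.
- exact: rb_runit_inv.
- exact: rb_trans (rb_whisker_r _ IHs) (rb_trans (rb_whisker_l _ IHt) (rb_wcat _ _)).
Qed.

Definition word_context a b c d (x : word a c) (y : word d b) : context c d a b :=
  c_left (word_scheme x) (c_right (c_hole c d) (word_scheme y)).

(** The schemes met on the way down to the hole are collected into one scheme on
    each side of it by associators, which are natural in the hole; these two
    schemes can then be rebracketed on their own. *)
Lemma ctx_equiv_word_context c d a b (K : context c d a b) :
  ctx_equiv K (word_context (word_before K) (word_after K)).
Proof.
elim: K => {a b} [| a a' b s K IH | a b b' K IH s] /=.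
- apply: ctx_equiv_sym; apply: ctx_equiv_trans (ctx_equiv_left_unit _) _.
  exact: ctx_equiv_right_unit.
- apply: ctx_equiv_trans (ctx_equiv_left s IH) _.
  apply: ctx_equiv_trans (ctx_equiv_sym (ctx_equiv_left_comp _ _ _)) _.
  apply: ctx_equiv_left_scheme.
  exact: rb_trans (rb_whisker_r _ (rb_underlying s)) (rb_wcat _ _).
- apply: ctx_equiv_trans (ctx_equiv_right s IH) _.
  apply: ctx_equiv_trans (ctx_equiv_left_right _ _ _) _.
  apply: ctx_equiv_left.
  apply: ctx_equiv_trans (ctx_equiv_right_comp _ _ _) _.
  apply: ctx_equiv_right_scheme.
  exact: rb_trans (rb_whisker_l _ (rb_underlying s)) (rb_wcat _ _).
Qed.

Lemma ctx_equiv_words c d a b (K L : context c d a b) :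
  word_before K = word_before L -> word_after K = word_after L -> ctx_equiv K L.
Proof.
move=> Eb Ea; apply: ctx_equiv_trans (ctx_equiv_word_context K) _.
by rewrite Eb Ea; apply: ctx_equiv_sym; exact: ctx_equiv_word_context.
Qed.

(** * Comparison of interpretations *)

(** Matching on the diagram keeps the layer of [J] literally that of [D], with no
    equation between dependent pairs left to invert. *)
Lemma interpretation_inv a b (w w' : word a b) (D : diagram w w')
    (s t : scheme a b) (J : interpretation D s t) :
  match D as D0 in diagram w w' return interpretation D0 s t -> Prop with
  | d_nil w => fun J => exists r, J = i_nil w r
  | d_cons L D => fun J =>
      exists K bE aE r J', J = @i_cons _ _ _ _ _ _ L D s t K bE aE r J'
  end J.
Proof.
case: J => {w w' D s t} [w s t r | w0 w1 wn L D s t K bE aE r J].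
- by exists r.
- by exists K, bE, aE, r, J.
Qed.

(** Allowing the two source schemes to differ by a rebracketing is what the
    induction needs: after one layer the two interpretations continue from
    different bracketings of the same word. *)
Lemma interpretation_rebracketing a b (w w' : word a b) (D : diagram w w')
    (s s' t : scheme a b) (r : rebracketing s s')
    (J : interpretation D s t) (J' : interpretation D s' t) :
  interpretation_cell J = rebracketing_cell r ;; interpretation_cell J'.
Proof.
elim: J s' r J' => {w w' D s t}
  [w s t q | w0 w1 wn L D s t K bE aE q J IH] s' r J'.
- have [q' ->] := interpretation_inv J'.
  exact: (rebracketing_coherence q (rb_trans r q')).
- have [K' [bE' [aE' [q' [{}J' ->]]]]] := interpretation_inv J'.
  have [rho rhoN] : ctx_equiv K K'.
    by apply: ctx_equiv_words; [rewrite bE | rewrite aE].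
  rewrite /= (IH _ (rho _) J') -!vcomp_assoc (vcomp_assoc _ (whisker _ _)) rhoN.
  rewrite -vcomp_assoc; congr (_ ;; _ ;; _).
  exact: (rebracketing_coherence (rb_trans q (rho _)) (rb_trans r q')).
Qed.

End Bicategory.

Theorem proposition4p1 (B : bicategory) (a b : Ob B) (w0 wn : word a b)
    (D : diagram w0 wn) (s t : scheme a b)
    (hs : underlying s = w0) (ht : underlying t = wn)
    (I1 I2 : interpretation D s t) :
  interpretation_cell I1 = interpretation_cell I2.
Proof.
by rewrite (interpretation_rebracketing (rb_refl s) I1 I2) vcomp_id_l.
Qed.
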